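(* Let $d\ge 1$, let $q$ be an integer with $d\le q\le 2d-1$, and let $\mu=(\mu_0,\ldots,\mu_q)\in\mathbb{R}^{q+1}$ be arbitrary. Let $S_q(\mu)\subset\mathcal{P}_d$ be the Prony leaf, i.e. the set of all $(A,X)\in\mathcal{P}_d$ with $\sum_{j=1}^d a_jx_j^k=\mu_k$ for $k=0,1,\ldots,q$, and let $S^X_q(\mu)\subset\mathcal{P}^X_d$ be its image under the projection $(A,X)\mapsto X$ onto the nodes space. Let $Y_q(\mu)\subset\mathcal{P}^X_d$ be the set of all $X=(x_1,\ldots,x_d)\in\mathcal{P}^X_d$ satisfying $$\sum_{i=0}^d\mu_{l-i}\,\sigma_i(x_1,\ldots,x_d)=0,\qquad l=d,d+1,\ldots,q.$$ Then $S^X_q(\mu)=Y_q(\mu)$.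
   Context: Parameter space: $\mathcal{P}^A_d=\mathbb{R}^d$ is the space of amplitudes $A=(a_1,\ldots,a_d)$; $\mathcal{P}^X_d=\{X=(x_1,\ldots,x_d)\in\mathbb{R}^d : x_1<x_2<\cdots<x_d\}$ is the space of nodes (nodes are always assumed pairwise different and ordered); $\mathcal{P}_d=\mathcal{P}^A_d\times\mathcal{P}^X_d$. The $\sigma_i$ are the signed (Vieta) elementary symmetric polynomials in $x_1,\ldots,x_d$: $\sigma_0=1$ and $\sigma_i(x_1,\ldots,x_d)=(-1)^i\sum_{1\le j_1<\cdots<j_i\le d}x_{j_1}\cdots x_{j_i}$ for $i=1,\ldots,d$, so that $\prod_{j=1}^d(z-x_j)=z^d+\sigma_1z^{d-1}+\cdots+\sigma_d$. No assumption is made on the rank or solvability of the linear system in $\sigma_1,\ldots,\sigma_d$; the sets involved may be empty. *)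

(* Defs.v *)
From mathcomp Require Import all_boot all_order all_algebra.
From mathcomp Require Import classical_sets reals.

Set Implicit Arguments.
Unset Strict Implicit.
Unset Printing Implicit Defensive.

Import GRing.Theory.
Local Open Scope ring_scope.
Local Open Scope classical_set_scope.

Definition amplitude_space (R : realType) (d : nat) : set 'rV[R]_d := setT.
Arguments amplitude_space : clear implicits.

Definition node_space (R : realType) (d : nat) : set 'rV[R]_d :=
  [set X | forall i j : 'I_d, (i < j)%N -> X 0 i < X 0 j].
Arguments node_space : clear implicits.

Definition parameter_space (R : realType) (d : nat) :
    set ('rV[R]_d * 'rV[R]_d) :=
  amplitude_space R d `*` node_space R d.
Arguments parameter_space : clear implicits.

(* The indices j_1 < ... < j_i are encoded by the i-element set they form;
   for i = 0 this is the empty set and the value is 1. *)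
Definition sigma (R : realType) (d i : nat) (X : 'rV[R]_d) : R :=
  (-1) ^+ i * \sum_(J : {set 'I_d} | #|J| == i) \prod_(j in J) X 0 j.

(* The convention 0 ^ 0 = 1 of expr0 is the one needed for the moment k = 0
   when some node vanishes. *)
Definition prony_leaf (R : realType) (d q : nat) (mu : 'rV[R]_q.+1) :
    set ('rV[R]_d * 'rV[R]_d) :=
  [set AX | parameter_space R d AX /\
    forall k : 'I_q.+1, \sum_(j < d) AX.1 0 j * AX.2 0 j ^+ k = mu 0 k].
Arguments prony_leaf {R} d {q} mu _.

Definition prony_leaf_nodes (R : realType) (d q : nat) (mu : 'rV[R]_q.+1) :
    set 'rV[R]_d :=
  snd @` prony_leaf d mu.
Arguments prony_leaf_nodes {R} d {q} mu _.

(* For i <= d <= l <= q the index l - i is an untruncated difference at most q,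
   so inord returns the index of that value. *)
Definition vieta_nodes (R : realType) (d q : nat) (mu : 'rV[R]_q.+1) :
    set 'rV[R]_d :=
  [set X | node_space R d X /\
    forall l : nat, (d <= l <= q)%N ->
      \sum_(i < d.+1) mu 0 (inord (l - i)) * sigma i X = 0].
Arguments vieta_nodes {R} d {q} mu _.

(* Main.v *)
(* The sigma_i are the coefficients of prod_j (z - x_j), so every node satisfies
   sum_i sigma_i x_j ^ (d - i) = 0; hence any moment sequence of X satisfies the
   linear recurrence with coefficients sigma_i.  Conversely, the Vandermonde
   matrix being invertible, some A matches the first d values of mu, and the
   recurrence shared by mu and the moments of (A, X) propagates the equality to
   all indices up to q. *)
Require Import Defs.
From mathcomp Require Import all_boot all_order all_algebra.
From mathcomp Require Import classical_sets reals.

Set Implicit Arguments.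
Unset Strict Implicit.
Unset Printing Implicit Defensive.

Import Order.TTheory GRing.Theory Num.Theory.
Local Open Scope ring_scope.

Lemma sigma0 (R : realType) (d : nat) (X : 'rV[R]_d) : sigma 0 X = 1.
Proof.
rewrite /sigma expr0 mul1r (eq_bigl (pred1 finset.set0)) => [|J]; last by rewrite /= cards_eq0.
by rewrite big_pred1_eq big_set0.
Qed.

(** Expanding the product picks [- X 0 j] for [j] in a subset [J] and [z] elsewhere; grouping the
    subsets by cardinality yields Vieta's formula. *)
Lemma prod_sub_nodes (R : realType) (d : nat) (X : 'rV[R]_d) (z : R) :
  \prod_(j < d) (z - X 0 j) = \sum_(i < d.+1) sigma i X * z ^+ (d - i).
Proof.
under eq_bigr do rewrite addrC.
rewrite bigA_distr (partition_big (fun J : {set 'I_d} => inord #|J| : 'I_d.+1) predT) //=.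
apply: eq_bigr => i _; rewrite /sigma mulr_sumr mulr_suml.
(* A subset of ['I_d] has at most [d] elements, so [inord] keeps its cardinality. *)
have cardE (J : {set 'I_d}) : (inord #|J| == i) = (#|J| == i :> nat).
  by rewrite -val_eqE /= inordK // ltnS -[X in (_ <= X)%N]card_ord max_card.
rewrite (eq_bigl _ _ cardE); apply: eq_bigr => J /eqP Ji.
rewrite (bigID (mem J)) /=; congr (_ * _).
  under eq_bigr => j jJ do rewrite jJ.
  by rewrite prodrN Ji.
under eq_bigr => j jJ do rewrite (negbTE jJ).
by rewrite prodr_const -Ji -[X in (X - _)%N](card_ord d) -(cardC (mem J)) addKn.
Qed.

Lemma sigma_annihilates_node (R : realType) (d : nat) (X : 'rV[R]_d) (j : 'I_d) :
  \sum_(i < d.+1) sigma i X * X 0 j ^+ (d - i) = 0.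
Proof. by rewrite -prod_sub_nodes (bigD1 j) //= subrr mul0r. Qed.

(** Weight the annihilation identity of node [j] by [A 0 j * X 0 j ^+ (l - d)] and sum over [j]. *)
Lemma moments_recurrence (R : realType) (d l : nat) (A X : 'rV[R]_d) :
  (d <= l)%N ->
  \sum_(i < d.+1) (\sum_(j < d) A 0 j * X 0 j ^+ (l - i)) * sigma i X = 0.
Proof.
move=> dl; under eq_bigr do rewrite mulr_suml.
rewrite exchange_big big1 //= => j _.
transitivity (A 0 j * X 0 j ^+ (l - d) * \sum_(i < d.+1) sigma i X * X 0 j ^+ (d - i)); last first.
  by rewrite sigma_annihilates_node mulr0.
rewrite mulr_sumr; apply: eq_bigr => i _.
have -> : (l - i = (l - d) + (d - i))%N by rewrite addnBA ?subnK // -ltnS.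
by rewrite exprD [sigma i X * _]mulrC !mulrA.
Qed.

Lemma node_space_inj (R : realType) (d : nat) (X : 'rV[R]_d) :
  node_space R d X -> injective (X 0).
Proof.
move=> Xlt i j Xij; apply/val_inj/eqP.
by case: ltngtP => // /Xlt; rewrite Xij ltxx.
Qed.

(** The Vandermonde determinant is a product of differences of distinct nodes, none of which
    vanishes. *)
Lemma Vandermonde_unitmx (F : fieldType) (d : nat) (X : 'rV[F]_d) :
  injective (X 0) -> Vandermonde d X \in unitmx.
Proof.
move=> Xinj; rewrite unitmxE det_Vandermonde unitfE.
apply/prodf_neq0 => i _; apply/prodf_neq0 => j ij.
by rewrite subr_eq0; apply: contraTneq ij => /Xinj ->; rewrite ltnn.
Qed.

Lemma moment_interpolation (F : fieldType) (d : nat) (X : 'rV[F]_d) (m : nat -> F) :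
  injective (X 0) ->
  exists A : 'rV[F]_d,
    forall k, (k < d)%N -> \sum_(j < d) A 0 j * X 0 j ^+ k = m k.
Proof.
move=> /Vandermonde_unitmx Vu; pose c : 'cV[F]_d := \col_k m k.
exists (invmx (Vandermonde d X) *m c)^T => k kd.
(* Row [k] of the Vandermonde system is the moment equation of order [k]. *)
have /matrixP/(_ (Ordinal kd) 0) := mulKVmx Vu c.
rewrite !mxE /= => <-; apply: eq_bigr => j _.
by rewrite !mxE mulrC.
Qed.

(** As [s 0 = 1], the relation at [l] determines the term of index [l] from the [d] preceding
    ones. *)
Lemma recurrence_unique (F : comPzRingType) (d q : nat) (s u v : nat -> F) :
  s 0 = 1 ->
  (forall k, (k < d)%N -> u k = v k) ->
  (forall l, (d <= l <= q)%N -> \sum_(i < d.+1) u (l - i)%N * s i = 0) ->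
  (forall l, (d <= l <= q)%N -> \sum_(i < d.+1) v (l - i)%N * s i = 0) ->
  forall k, (k <= q)%N -> u k = v k.
Proof.
move=> s0 uv_lt urec vrec; elim/ltn_ind => k IHk kq.
have [/uv_lt //|dk] := ltnP k d.
have dkq : (d <= k <= q)%N by rewrite dk.
have := etrans (urec k dkq) (esym (vrec k dkq)).
(* Splitting off [i = 0] isolates [u k] and [v k]; the remaining sums agree by induction and
   cancel. *)
rewrite !big_ord_recl /= s0 !mulr1 subn0.
rewrite (eq_bigr (fun i : 'I_d => v (k - bump 0 i)%N * s (bump 0 i))).
  by move/addIr.
move=> i _; congr (_ * _); apply: IHk; last exact: leq_trans (leq_subr _ _) kq.
by rewrite /bump ltn_subrL (leq_trans _ dk) // (leq_ltn_trans _ (ltn_ord i)).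
Qed.

Theorem theorem4p2 (R : realType) (d q : nat) (mu : 'rV[R]_q.+1)
    (hd : (1 <= d)%N) (hq : (d <= q <= 2 * d - 1)%N) :
  prony_leaf_nodes d mu = vieta_nodes d mu.
Proof.
apply/seteqP; split=> X.
  case=> -[A Y] [[_ Ylt] /= moments] <-; split=> // l /andP[dl lq].
  apply: etrans (moments_recurrence A Y dl); apply: eq_bigr => i _.
  by rewrite -moments inordK // ltnS (leq_trans (leq_subr _ _) lq).
case=> Xlt vieta.
(* [inord] extends [mu] to a sequence on [nat]; its default value beyond [q] is harmless, since only
   indices up to [q] are ever compared. *)
have [A Ainterp] := moment_interpolation (fun k => mu 0 (inord k)) (node_space_inj Xlt).
exists (A, X) => //; split=> [//|k] /=.
rewrite -[in RHS](inord_val k).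
apply: (recurrence_unique (s := fun i => sigma i X) (sigma0 X) Ainterp) (leq_ord k) => l /andP[dl lq].
  exact: moments_recurrence.
by apply: vieta; rewrite dl.
Qed.
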